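(* Let $P_n$ be a real polynomial of degree $n$, let $\varepsilon\in\mathbb{R}$ be a (small) parameter, and let $\varphi:\mathbb{R}^2\to\mathbb{R}$ be a smooth function such that the relations $$\bar x+\varepsilon\varphi(\bar y,\bar x)=y+\varepsilon\varphi(x,y),\qquad \bar y=-x+P_n\bigl(y+\varepsilon\varphi(x,y)\bigr)$$ define a diffeomorphism $\tilde H_n(\varepsilon):(x,y)\mapsto(\bar x,\bar y)$ of the plane. Then $\tilde H_n(\varepsilon)$ is reversible with respect to the involution $h:(x,y)\mapsto(y,x)$, i.e. $\tilde H_n(\varepsilon)^{-1}=h\circ\tilde H_n(\varepsilon)\circ h$.
   Context: A diffeomorphism $f$ is called reversible with respect to an involution $h$ (a map with $h\circ h=\mathrm{Id}$) if $f^{-1}=h\circ f\circ h$. The map $\tilde H_n(\varepsilon)$ is given implicitly: $(\bar x,\bar y)$ is the image of $(x,y)$ if and only if the two displayed relations hold. *)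

(* Defs.v *)
From mathcomp Require Import all_boot all_order all_algebra.
From mathcomp Require Import all_classical all_reals all_analysis.

Set Implicit Arguments.
Unset Strict Implicit.
Unset Printing Implicit Defensive.

Import Order.TTheory GRing.Theory Num.Theory.
Import numFieldNormedType.Exports.

Local Open Scope ring_scope.

(* On the finite-dimensional domain R * R, f is C^(k+1) iff it is (Frechet)
   differentiable everywhere and all its directional derivatives are C^k. *)
Fixpoint Ck (R : realType) (W : normedModType R) (k : nat)
    (f : R * R -> W) : Prop :=
  match k with
  | 0 => continuous f
  | k'.+1 => (forall p, differentiable f p) /\ (forall v, Ck k' ('D_v f))
  end.

Definition smooth (R : realType) (W : normedModType R) (f : R * R -> W) : Prop :=
  forall k, Ck k f.

Record diffeo (R : realType) := Diffeo {
  diffeo_fun :> R * R -> R * R;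
  diffeo_inv : R * R -> R * R;
  diffeo_funK : cancel diffeo_fun diffeo_inv;
  diffeo_invK : cancel diffeo_inv diffeo_fun;
  diffeo_fun_smooth : smooth diffeo_fun;
  diffeo_inv_smooth : smooth diffeo_inv }.

Definition reversible (R : realType) (f : diffeo R) (h : R * R -> R * R) : Prop :=
  involutive h /\ diffeo_inv f = h \o f \o h.

(* Main.v *)
Require Import Defs.
From mathcomp Require Import all_boot all_order all_algebra.
From mathcomp Require Import all_classical all_reals all_analysis.

Import Order.TTheory GRing.Theory Num.Theory.
Import numFieldNormedType.Exports.

Local Open Scope ring_scope.

Theorem lemma2 (R : realType) (n : nat) (P : {poly R}) (hP : size P = n.+1)
    (eps : R) (phi : R * R -> R) (hphi : smooth phi) (H : diffeo R)
    (hH : forall x y xbar ybar : R,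
      H (x, y) = (xbar, ybar) <->
      xbar + eps * phi (ybar, xbar) = y + eps * phi (x, y) /\
      ybar = - x + P.[y + eps * phi (x, y)]) :
  reversible H (@swap_pair R R).
Proof.
split=> [[] //|]; apply/funext => -[a b] /=.
(* Here [(b, a)] is the swap of [(a, b)], so the goal becomes [diffeo_inv H (a, b) = (d, c)]; by
   [diffeo_funK] it is enough that [H] sends [(d, c)] to [(a, b)]. *)
case E: (H (b, a)) => [c d].
have /hH [e1 e2] := E.
(* The system defining H is invariant under x <-> ybar, y <-> xbar. *)
suff <- : H (d, c) = (a, b) by rewrite diffeo_funK.
(* The first relation for [(d, c)] is [e1] reversed. Since [e1] also makes both arguments of [P]
   equal, the second is [e2] solved for [b]: [b = - d + P.[a + eps * phi (b, a)]]. *)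
by apply/hH; rewrite e1 e2 opprD opprK subrK.
Qed.
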